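(* Let $\mathfrak A$ be a model (universe $A$) pointwise definable by the formulas in $\Theta=\{\theta_a:a\in A\}$, let $\mathrm{T}$ be a first-order theory, $\vdash$ a provability relation, and $U$ a unary predicate symbol, and assume $\Theta$ is a set of uniqueness formulas in $(\mathrm{T},\vdash)$. Assume that $\mathrm{T}\vdash\forall x\,(\theta_a(x)\to U(x))$ for all $a\in A$, and that for every sentence $\sigma$: if $\sigma\in\mathrm{Dg}_\Theta(\mathfrak A)$ then $\mathrm{T}\vdash\sigma^U$, and if $\mathrm{T}\vdash\sigma^U$ then $\mathfrak A\vDash\sigma$. Then for every sentence $\sigma$, $\mathrm{T}\vdash^U_\Theta\sigma^U$ iff $\mathfrak A\vDash\sigma$; i.e., $\{\sigma^U:\mathrm{T}\vdash^U_\Theta\sigma^U\}=\mathrm{Th}^U(\mathfrak A)$.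
   Context: First-order finitary logic. A provability relation $\vdash$ is that of classical first-order logic or any stronger one. A formula $\theta(x)$ in one free variable is a uniqueness formula in $(\mathrm{T},\vdash)$ iff $\mathrm{T}\vdash\exists x\,(\theta(x)\wedge\forall y\,(\theta(y)\to x=y))$. $\mathfrak A$ is pointwise definable by $\Theta=\{\theta_a:a\in A\}$ iff for each $a\in A$, $a$ is the unique element of $\mathfrak A$ satisfying $\theta_a$. A sentence is $\Theta$-atomic iff it has the form $\exists x_0\ldots\exists x_n\,(\varphi(x_0,\dots,x_n)\wedge\theta_0(x_0)\wedge\dots\wedge\theta_n(x_n))$ with $\varphi$ atomic and $\theta_i\in\Theta$; the generalized diagram $\mathrm{Dg}_\Theta(\mathfrak A)$ is the set of all $\Theta$-atomic and negated $\Theta$-atomic sentences true in $\mathfrak A$. $\psi^U$ is the relativization of $\psi$ to $U$, and $\mathrm{Th}^U(\mathfrak A)=\{\sigma^U:\mathfrak A\vDash\sigma\}$. The $(\Theta,U)$-rule infers $(\forall x\,\varphi(x))^U$ from $\{(\exists x\,(\varphi(x)\wedge\theta(x)))^U:\theta\in\Theta\}$ for each formula $\varphi$ in one free variable $x$; $\vdash^U_\Theta$ is $\vdash$ plus this rule.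
   Formalization: Added: T also proves the relativization to U of each uniqueness sentence of θ_a (false otherwise, as θ_a^U may differ from θ_a on U); ⊢ is closed under cut, finitary and satisfies the deduction theorem; φ in the (Θ,U)-rule ranges over formulas of the language of the model. *)

(* Defs.v *)
From Stdlib Require List.
From mathcomp Require Import all_boot.

Set Implicit Arguments.
Unset Strict Implicit.
Unset Printing Implicit Defensive.

(* First-order logic with equality over an arbitrary signature, with
   well-scoped de Bruijn variables: [form L n] is the type of formulas whose
   free variables are among 0, ..., n-1. *)

Record signature := Signature {
  fsym : Type;
  far : fsym -> nat;
  rsym : Type;
  rar : rsym -> nat
}.

Inductive term (L : signature) (n : nat) : Type :=
| Var (i : 'I_n)
| App (f : fsym L) (ts : 'I_(far f) -> term L n).

Inductive form (L : signature) (n : nat) : Type :=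
| Bot
| Eq (s t : term L n)
| Rel (r : rsym L) (ts : 'I_(rar r) -> term L n)
| Imp (p q : form L n)
| And (p q : form L n)
| Or (p q : form L n)
| All (p : form L n.+1)
| Ex (p : form L n.+1).

Arguments Var {L n} i.
Arguments App {L n} f ts.
Arguments Bot {L n}.
Arguments Eq {L n} s t.
Arguments Rel {L n} r ts.
Arguments Imp {L n} p q.
Arguments And {L n} p q.
Arguments Or {L n} p q.
Arguments All {L n} p.
Arguments Ex {L n} p.

Definition Not L n (p : form L n) : form L n := Imp p Bot.

Notation sentence L := (form L 0).
Notation theory L := (form L 0 -> Prop).

(* Index 0 gets [x], index i+1 gets [f i]. *)
Definition scons {T : Type} {n : nat} (x : T) (f : 'I_n -> T) (i : 'I_n.+1) : T :=
  if unlift ord0 i is Some j then f j else x.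

Fixpoint subst_term L m n (sg : 'I_m -> term L n) (t : term L m) : term L n :=
  match t with
  | Var i => sg i
  | App f ts => App f (fun i => subst_term sg (ts i))
  end.

Definition shift L n (i : 'I_n) : term L n.+1 := Var (lift ord0 i).

Definition up L m n (sg : 'I_m -> term L n) : 'I_m.+1 -> term L n.+1 :=
  scons (Var ord0) (fun i => subst_term (@shift L n) (sg i)).

Fixpoint subst L m (p : form L m) : forall n, ('I_m -> term L n) -> form L n :=
  match p with
  | Bot => fun _ _ => Bot
  | Eq s t => fun _ sg => Eq (subst_term sg s) (subst_term sg t)
  | Rel r ts => fun _ sg => Rel r (fun i => subst_term sg (ts i))
  | Imp p q => fun _ sg => Imp (subst p sg) (subst q sg)
  | And p q => fun _ sg => And (subst p sg) (subst q sg)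
  | Or p q => fun _ sg => Or (subst p sg) (subst q sg)
  | All p => fun _ sg => All (subst p (up sg))
  | Ex p => fun _ sg => Ex (subst p (up sg))
  end.

Definition weaken L n (p : form L n) : form L n.+1 := subst p (@shift L n).

(* [inst p t] replaces the variable of index 0 by [t]. *)
Definition inst L n (p : form L n.+1) (t : term L n) : form L n :=
  subst p (scons t Var).

(* [app1 p t] is p(t), for [p] in one free variable. *)
Definition app1 L n (p : form L 1) (t : term L n) : form L n :=
  subst p (fun _ => t).

Fixpoint exs L n : form L n -> sentence L :=
  match n with
  | 0 => id
  | k.+1 => fun p => exs (Ex p)
  end.

Record structure (L : signature) := Structure {
  carrier :> Type;
  fint : forall f : fsym L, ('I_(far f) -> carrier) -> carrier;
  rint : forall r : rsym L, ('I_(rar r) -> carrier) -> Prop;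
  carrier_inh : inhabited carrier
}.

Fixpoint eval L (A : structure L) n (rho : 'I_n -> A) (t : term L n) : A :=
  match t with
  | Var i => rho i
  | App f ts => fint (fun i => eval rho (ts i))
  end.

Fixpoint sat L (A : structure L) n (p : form L n) : ('I_n -> A) -> Prop :=
  match p with
  | Bot => fun _ => False
  | Eq s t => fun rho => eval rho s = eval rho t
  | Rel r ts => fun rho => rint (fun i => eval rho (ts i))
  | Imp p q => fun rho => sat p rho -> sat q rho
  | And p q => fun rho => sat p rho /\ sat q rho
  | Or p q => fun rho => sat p rho \/ sat q rho
  | All p => fun rho => forall a : A, sat p (scons a rho)
  | Ex p => fun rho => exists a : A, sat p (scons a rho)
  end.

(* There is exactly one assignment 'I_0 -> A. *)
Definition models L (A : structure L) (s : sentence L) : Prop :=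
  forall rho : 'I_0 -> A, sat s rho.

(* Classical natural deduction.  Since a scope may contain no term at all,
   non-emptiness of the domain is the explicit rule [nd_dom]. *)
Inductive nd L (n : nat) (G : seq (form L n)) : form L n -> Prop :=
| nd_hyp p : List.In p G -> nd G p
| nd_raa p : nd (Not p :: G) Bot -> nd G p
| nd_impI p q : nd (p :: G) q -> nd G (Imp p q)
| nd_impE p q : nd G (Imp p q) -> nd G p -> nd G q
| nd_andI p q : nd G p -> nd G q -> nd G (And p q)
| nd_andE1 p q : nd G (And p q) -> nd G p
| nd_andE2 p q : nd G (And p q) -> nd G q
| nd_orI1 p q : nd G p -> nd G (Or p q)
| nd_orI2 p q : nd G q -> nd G (Or p q)
| nd_orE p q r : nd G (Or p q) -> nd (p :: G) r -> nd (q :: G) r -> nd G r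
| nd_allI p : @nd L n.+1 [seq weaken g | g <- G] p -> nd G (All p)
| nd_allE p t : nd G (All p) -> nd G (inst p t)
| nd_exI p t : nd G (inst p t) -> nd G (Ex p)
| nd_exE p q : nd G (Ex p) ->
    @nd L n.+1 (p :: [seq weaken g | g <- G]) (weaken q) -> nd G q
| nd_eqI t : nd G (Eq t t)
| nd_eqE p s t : nd G (Eq s t) -> nd G (inst p s) -> nd G (inst p t)
| nd_dom : nd G (Ex (Eq (Var ord0) (Var ord0))).

Definition classical_prv L (T : theory L) (s : sentence L) : Prop :=
  exists G : seq (sentence L), (forall g, List.In g G -> T g) /\ nd G s.

(* A provability relation: classical first-order provability or a stronger
   finitary consequence relation satisfying the deduction theorem
   (equivalently: classical provability from additional logical axioms). *)
Record provability L (P : theory L -> sentence L -> Prop) : Prop := Provability {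
  prv_classical : forall T s, classical_prv T s -> P T s;
  prv_cut : forall T S s, (forall t, S t -> P T t) -> P S s -> P T s;
  prv_finitary : forall T s, P T s ->
    exists G : seq (sentence L),
      (forall g, List.In g G -> T g) /\ P (fun g => List.In g G) s;
  prv_deduction : forall T s t, P (fun g => T g \/ g = s) t -> P T (Imp s t)
}.

(* [sig_ext L E] is a language extending [L] by the symbols of [E]. *)
Definition sig_ext (L E : signature) : signature :=
  @Signature (fsym L + fsym E)
    (fun f => match f with inl f => far f | inr f => far f end)
    (rsym L + rsym E)
    (fun r => match r with inl r => rar r | inr r => rar r end).

Fixpoint embed_term L E n (t : term L n) : term (sig_ext L E) n :=
  match t with
  | Var i => Var i
  | App f ts => @App (sig_ext L E) n (inl f) (fun i => embed_term E (ts i))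
  end.

Fixpoint embed L E n (p : form L n) : form (sig_ext L E) n :=
  match p with
  | Bot => Bot
  | Eq s t => Eq (embed_term E s) (embed_term E t)
  | Rel r ts => @Rel (sig_ext L E) n (inl r) (fun i => embed_term E (ts i))
  | Imp p q => Imp (embed E p) (embed E q)
  | And p q => And (embed E p) (embed E q)
  | Or p q => Or (embed E p) (embed E q)
  | All p => All (embed E p)
  | Ex p => Ex (embed E p)
  end.

(* U(t); only meaningful when [U] is unary. *)
Definition Pred1 L n (U : rsym L) (t : term L n) : form L n :=
  Rel U (fun _ => t).

Fixpoint relativize L (U : rsym L) n (p : form L n) : form L n :=
  match p with
  | Bot => Bot
  | Eq s t => Eq s t
  | Rel r ts => Rel r ts
  | Imp p q => Imp (relativize U p) (relativize U q)
  | And p q => And (relativize U p) (relativize U q)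
  | Or p q => Or (relativize U p) (relativize U q)
  | All p => All (Imp (Pred1 U (Var ord0)) (relativize U p))
  | Ex p => Ex (And (Pred1 U (Var ord0)) (relativize U p))
  end.

(* psi^U for psi in the language of the model and U in the language of the
   theory. *)
Definition rel_to L E (U : rsym (sig_ext L E)) n (p : form L n) :
    form (sig_ext L E) n :=
  relativize U (embed E p).

(* ex x (th(x) /\ all y (th(y) -> x = y)); under the second quantifier y has
   index 0 and x has index 1. *)
Definition uniq_sentence L (th : form L 1) : sentence L :=
  Ex (And th
    (All (Imp (app1 th (Var ord0)) (Eq (Var (lift ord0 ord0)) (Var ord0))))).

Definition uniqueness_formula L (P : theory L -> sentence L -> Prop)
    (T : theory L) (th : form L 1) : Prop :=
  P T (uniq_sentence th).

Definition pointwise_definable L (A : structure L) (th : A -> form L 1) : Prop :=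
  forall a b : A, sat (th a) (fun _ => b) <-> b = a.

Definition atomic L n (p : form L n) : Prop :=
  match p with
  | Eq _ _ | Rel _ _ => True
  | _ => False
  end.

Definition range_of L (A : structure L) (th : A -> form L 1) : form L 1 -> Prop :=
  fun p => exists a : A, p = th a.

(* ex x_0 ... ex x_n (phi /\ th_0(x_0) /\ ... /\ th_n(x_n)).  The outermost of
   the n+1 quantifiers binds index n, so x_i is the variable of index n - i. *)
Definition theta_atomic L (Th : form L 1 -> Prop) (s : sentence L) : Prop :=
  exists (n : nat) (phi : form L n.+1) (th : 'I_n.+1 -> form L 1),
    [/\ atomic phi, (forall i, Th (th i)) &
        s = exs (foldl And phi
                   [seq app1 (th i) (Var (rev_ord i)) | i <- enum 'I_n.+1])].

Definition diagram L (Th : form L 1 -> Prop) (A : structure L)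
    (s : sentence L) : Prop :=
  (theta_atomic Th s \/ exists2 r, theta_atomic Th r & s = Not r) /\ models A s.

(* P extended by the (Th,U)-rule: the closure of T under P and the rule. *)
Inductive rule_prv L E (P : theory (sig_ext L E) -> sentence (sig_ext L E) -> Prop)
    (Th : form L 1 -> Prop) (U : rsym (sig_ext L E)) (T : theory (sig_ext L E)) :
    sentence (sig_ext L E) -> Prop :=
| rule_prv_ax s : T s -> rule_prv P Th U T s
| rule_prv_base (S : theory (sig_ext L E)) s :
    (forall t, S t -> rule_prv P Th U T t) -> P S s -> rule_prv P Th U T s
| rule_prv_rule (phi : form L 1) :
    (forall th, Th th -> rule_prv P Th U T (rel_to U (Ex (And phi th)))) ->
    rule_prv P Th U T (rel_to U (All phi)).

Definition Th_rel L E (U : rsym (sig_ext L E)) (A : structure L)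
    (t : sentence (sig_ext L E)) : Prop :=
  exists2 s : sentence L, t = rel_to U s & models A s.

(* Main.v *)
(* Soundness: by the deduction theorem, T_sound extends from T to T together with
   Th^U(A), since a finite set of true premises tau^U can be moved into the
   conclusion.  The consequences of T u Th^U(A) are then closed under the
   (Theta,U)-rule, because every element of A satisfies some theta_a.

   Completeness: by induction on p, if [sat p rho] (resp. not) then p^U (resp. its
   negation) is derivable, from finitely many provable sentences, in the context
   U(x_i), theta_(rho i)^U(x_i).  Atomic formulas come from the diagram.  For the
   universal quantifier the rule only admits a formula in one variable; the other
   variables are eliminated by quantifying them existentially together with the
   uniqueness formulas that name their values. *)

Require Import Defs.
From Stdlib Require Import Classical FunctionalExtensionality.
From mathcomp Require Import all_boot.

Set Implicit Arguments.
Unset Strict Implicit.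
Unset Printing Implicit Defensive.

(** * Substitution *)

Lemma scons_ord0 T n (x : T) (f : 'I_n -> T) : scons x f ord0 = x.
Proof. by rewrite /scons unlift_none. Qed.

Lemma scons_lift T n (x : T) (f : 'I_n -> T) i : scons x f (lift ord0 i) = f i.
Proof. by rewrite /scons liftK. Qed.

Definition sconsE := (scons_ord0, scons_lift).

Lemma ord_funext T n (f g : 'I_n.+1 -> T) :
  f ord0 = g ord0 -> (forall i, f (lift ord0 i) = g (lift ord0 i)) -> f = g.
Proof.
move=> e0 eS; apply: functional_extensionality => i.
by case: (unliftP ord0 i) => [j|] ->.
Qed.

Lemma ord0_funext T (f g : 'I_0 -> T) : f = g.
Proof. by apply: functional_extensionality => -[]. Qed.

Lemma scons_eta T n (f : 'I_n.+1 -> T) :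
  f = scons (f ord0) (fun i => f (lift ord0 i)).
Proof. by apply: ord_funext => [|i]; rewrite sconsE. Qed.

Section Substitution.
Variable L : signature.

Lemma subst_term_comp m n k (sg : 'I_m -> term L n) (tau : 'I_n -> term L k) t :
  subst_term tau (subst_term sg t) = subst_term (fun i => subst_term tau (sg i)) t.
Proof.
elim: t => [//|f ts IH] /=; congr App.
by apply: functional_extensionality => i.
Qed.

Lemma subst_term_id n (t : term L n) : subst_term Var t = t.
Proof.
elim: t => [//|f ts IH] /=; congr App.
by apply: functional_extensionality => i.
Qed.

Lemma up_comp m n k (sg : 'I_m -> term L n) (tau : 'I_n -> term L k) :
  (fun i => subst_term (up tau) (up sg i)) = up (fun i => subst_term tau (sg i)).
Proof.
apply: ord_funext => [|i]; rewrite /up !sconsE /= ?sconsE //.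
rewrite !subst_term_comp; congr (subst_term _ (sg i)).
by apply: functional_extensionality => j /=; rewrite sconsE.
Qed.

Lemma up_id n : up (@Var L n) = Var.
Proof. by apply: ord_funext => [|i]; rewrite /up sconsE. Qed.

Lemma subst_comp m (p : form L m) :
  forall n k (sg : 'I_m -> term L n) (tau : 'I_n -> term L k),
  subst (subst p sg) tau = subst p (fun i => subst_term tau (sg i)).
Proof.
elim: p => {m} [m|m s t|m r ts|m p IHp q IHq|m p IHp q IHq|m p IHp q IHq
  |m p IHp|m p IHp] n k sg tau //=.
- by rewrite !subst_term_comp.
- by congr Rel; apply: functional_extensionality => i; rewrite subst_term_comp.
- by rewrite IHp IHq.
- by rewrite IHp IHq.
- by rewrite IHp IHq.
- by rewrite IHp up_comp.
- by rewrite IHp up_comp.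
Qed.

Lemma subst_id n (p : form L n) : subst p Var = p.
Proof.
elim: p => {n} [n|n s t|n r ts|n p IHp q IHq|n p IHp q IHq|n p IHp q IHq
  |n p IHp|n p IHp] //=.
- by rewrite !subst_term_id.
- by congr Rel; apply: functional_extensionality => i; rewrite subst_term_id.
- by rewrite IHp IHq.
- by rewrite IHp IHq.
- by rewrite IHp IHq.
- by rewrite up_id IHp.
- by rewrite up_id IHp.
Qed.

Lemma subst_app1 m n (p : form L 1) t (sg : 'I_m -> term L n) :
  subst (app1 p t) sg = app1 p (subst_term sg t).
Proof. by rewrite /app1 subst_comp. Qed.

Lemma app1_id (p : form L 1) : app1 p (Var ord0) = p.
Proof.
rewrite /app1 -[RHS]subst_id; congr subst.
by apply: ord_funext => [//|[]].
Qed.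

Lemma subst_inst m n (p : form L m.+1) t (sg : 'I_m -> term L n) :
  subst (inst p t) sg = inst (subst p (up sg)) (subst_term sg t).
Proof.
rewrite /inst !subst_comp; congr subst.
apply: ord_funext => [|i]; rewrite /up !sconsE /= ?sconsE //.
rewrite subst_term_comp -[LHS]subst_term_id; congr subst_term.
by apply: functional_extensionality => j /=; rewrite sconsE.
Qed.

Lemma weaken_subst m n (p : form L m) (sg : 'I_m -> term L n) :
  weaken (subst p sg) = subst (weaken p) (up sg).
Proof.
rewrite /weaken !subst_comp; congr subst.
by apply: functional_extensionality => i /=; rewrite /up sconsE.
Qed.

Lemma inst_up n (p : form L n.+1) : inst (subst p (up (@shift L n))) (Var ord0) = p.
Proof.
rewrite /inst subst_comp -[RHS]subst_id; congr subst.
by apply: ord_funext => [|i]; rewrite /up !sconsE /= ?sconsE.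
Qed.

(** The substitution has empty domain, so its values are immaterial. This lets a sentence be used as
    a hypothesis in a scope with [n] variables. *)
Definition lift0 n (s : sentence L) : form L n :=
  subst s (fun i : 'I_0 => Var (widen_ord (leq0n n) i)).

Lemma lift0_0 s : lift0 0 s = s.
Proof. by rewrite -[RHS]subst_id /lift0; congr subst; apply: ord0_funext. Qed.

Lemma subst_lift0 m n s (sg : 'I_m -> term L n) : subst (lift0 m s) sg = lift0 n s.
Proof. by rewrite /lift0 subst_comp; congr subst; apply: ord0_funext. Qed.

(** * Substitution against satisfaction, relativization and embedding *)

Lemma eval_subst (A : structure L) m n (t : term L m) (sg : 'I_m -> term L n)
    (rho : 'I_n -> A) :
  eval rho (subst_term sg t) = eval (fun i => eval rho (sg i)) t.
Proof.
elim: t => [//|f ts IH] /=; congr fint.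
by apply: functional_extensionality => i.
Qed.

Lemma sat_subst (A : structure L) m (p : form L m) :
  forall n (sg : 'I_m -> term L n) (rho : 'I_n -> A),
  sat (subst p sg) rho <-> sat p (fun i => eval rho (sg i)).
Proof.
have upE m' n' (sg : 'I_m' -> term L n') (rho : 'I_n' -> A) a :
  (fun i => eval (scons a rho) (up sg i)) = scons a (fun i => eval rho (sg i)).
  apply: ord_funext => [|i]; rewrite /up !sconsE /= ?sconsE //.
  rewrite eval_subst; congr eval.
  by apply: functional_extensionality => j /=; rewrite sconsE.
elim: p => {m} [m|m s t|m r ts|m p IHp q IHq|m p IHp q IHq|m p IHp q IHq
  |m p IHp|m p IHp] n sg rho //=.
- by rewrite !eval_subst.
- suff -> : (fun i => eval rho (subst_term sg (ts i))) =
            (fun i => eval (fun j => eval rho (sg j)) (ts i)) by [].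
  by apply: functional_extensionality => i; rewrite eval_subst.
- by rewrite IHp IHq.
- by rewrite IHp IHq.
- by rewrite IHp IHq.
- by split=> H a; move: (H a); rewrite IHp upE.
- by split=> -[a H]; exists a; move: H; rewrite IHp upE.
Qed.

Lemma relativize_subst (U : rsym L) m (p : form L m) :
  forall n (sg : 'I_m -> term L n),
  relativize U (subst p sg) = subst (relativize U p) sg.
Proof.
elim: p => {m} [m|m s t|m r ts|m p IHp q IHq|m p IHp q IHq|m p IHp q IHq
  |m p IHp|m p IHp] n sg //=; rewrite ?IHp ?IHq //.
- by rewrite /Pred1 /up sconsE.
- by rewrite /Pred1 /up sconsE.
Qed.

End Substitution.

Lemma embed_term_subst L E m n (t : term L m) (sg : 'I_m -> term L n) :
  embed_term E (subst_term sg t) =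
  subst_term (fun i => embed_term E (sg i)) (embed_term E t).
Proof.
elim: t => [//|f ts IH] /=; congr App.
by apply: functional_extensionality => i.
Qed.

Lemma embed_subst L E m (p : form L m) : forall n (sg : 'I_m -> term L n),
  embed E (subst p sg) = subst (embed E p) (fun i => embed_term E (sg i)).
Proof.
have upE m' n' (sg : 'I_m' -> term L n') :
  (fun i => embed_term E (up sg i)) = up (fun i => embed_term E (sg i)).
  apply: ord_funext => [|i]; rewrite /up !sconsE //.
  by rewrite embed_term_subst.
elim: p => {m} [m|m s t|m r ts|m p IHp q IHq|m p IHp q IHq|m p IHp q IHq
  |m p IHp|m p IHp] n sg //=; rewrite ?IHp ?IHq ?upE //.
- by rewrite !embed_term_subst.
- by congr Rel; apply: functional_extensionality => i; rewrite embed_term_subst.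
Qed.

Lemma rel_to_subst L E (U : rsym (sig_ext L E)) m n (p : form L m)
    (sg : 'I_m -> term L n) :
  rel_to U (subst p sg) = subst (rel_to U p) (fun i => embed_term E (sg i)).
Proof. by rewrite /rel_to embed_subst relativize_subst. Qed.

Lemma rel_to_app1 L E (U : rsym (sig_ext L E)) n (p : form L 1) (i : 'I_n) :
  rel_to U (app1 p (Var i)) = app1 (rel_to U p) (Var i).
Proof. exact: rel_to_subst. Qed.

(** * Natural deduction over open formulas *)

Section Deduction.
Variable L : signature.

Lemma nd_weakening n (G : seq (form L n)) p : nd G p ->
  forall G', (forall g, List.In g G -> List.In g G') -> nd G' p.
Proof.
have consP m (q : form L m) H H' : (forall g, List.In g H -> List.In g H') ->
  forall g, List.In g (q :: H) -> List.In g (q :: H').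
  by move=> sub g /= [->|/sub]; [left|right].
have mapP m (H H' : seq (form L m)) : (forall g, List.In g H -> List.In g H') ->
  forall g, List.In g [seq weaken h | h <- H] -> List.In g [seq weaken h | h <- H'].
  move=> sub g /List.in_map_iff[h [<- /sub ?]].
  exact: List.in_map.
elim=> {n G p}.
- by move=> n G p Gp G' sub; apply/nd_hyp/sub.
- by move=> n G p _ IH G' sub; apply/nd_raa/IH/consP.
- by move=> n G p q _ IH G' sub; apply/nd_impI/IH/consP.
- by move=> n G p q _ IH1 _ IH2 G' sub; apply: nd_impE (IH1 _ sub) (IH2 _ sub).
- by move=> n G p q _ IH1 _ IH2 G' sub; apply: nd_andI (IH1 _ sub) (IH2 _ sub).
- by move=> n G p q _ IH G' sub; apply: nd_andE1 (IH _ sub).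
- by move=> n G p q _ IH G' sub; apply: nd_andE2 (IH _ sub).
- by move=> n G p q _ IH G' sub; apply: nd_orI1 (IH _ sub).
- by move=> n G p q _ IH G' sub; apply: nd_orI2 (IH _ sub).
- move=> n G p q r _ IH1 _ IH2 _ IH3 G' sub.
  by apply: nd_orE (IH1 _ sub) (IH2 _ (consP _ _ _ _ sub)) (IH3 _ (consP _ _ _ _ sub)).
- by move=> n G p _ IH G' sub; apply/nd_allI/IH/mapP.
- by move=> n G p t _ IH G' sub; apply/nd_allE/IH.
- by move=> n G p t _ IH G' sub; apply: nd_exI (IH _ sub).
- by move=> n G p q _ IH1 _ IH2 G' sub; apply: nd_exE (IH1 _ sub) _; apply/IH2/consP/mapP.
- by move=> n G t G' _; apply: nd_eqI.
- by move=> n G p s t _ IH1 _ IH2 G' sub; apply: nd_eqE (IH1 _ sub) (IH2 _ sub).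
- by move=> n G G' _; apply: nd_dom.
Qed.

(** The quantifier rules survive because substituting under a binder commutes with weakening the
    context. *)
Lemma nd_subst n (G : seq (form L n)) p : nd G p ->
  forall m (sg : 'I_n -> term L m), nd [seq subst g sg | g <- G] (subst p sg).
Proof.
have mapE n' m (G' : seq (form L n')) (sg : 'I_n' -> term L m) :
  [seq subst g (up sg) | g <- [seq weaken g | g <- G']] =
  [seq weaken g | g <- [seq subst g sg | g <- G']].
  by rewrite -!map_comp; apply: eq_map => g /=; rewrite weaken_subst.
elim=> {n G p}.
- by move=> n G p Gp m sg; apply: nd_hyp; apply: List.in_map (fun g => subst g sg) _ _ Gp.
- by move=> n G p _ IH m sg; apply/nd_raa/IH.
- by move=> n G p q _ IH m sg; apply/nd_impI/IH.
- by move=> n G p q _ IH1 _ IH2 m sg; apply: nd_impE (IH1 _ sg) (IH2 _ sg).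
- by move=> n G p q _ IH1 _ IH2 m sg; apply: nd_andI (IH1 _ sg) (IH2 _ sg).
- by move=> n G p q _ IH m sg; apply: nd_andE1 (IH _ sg).
- by move=> n G p q _ IH m sg; apply: nd_andE2 (IH _ sg).
- by move=> n G p q _ IH m sg; apply: nd_orI1 (IH _ sg).
- by move=> n G p q _ IH m sg; apply: nd_orI2 (IH _ sg).
- move=> n G p q r _ IH1 _ IH2 _ IH3 m sg.
  exact: nd_orE (IH1 _ sg) (IH2 _ sg) (IH3 _ sg).
- by move=> n G p _ IH m sg; apply: nd_allI; rewrite -mapE; apply: IH.
- by move=> n G p t _ IH m sg; rewrite subst_inst; apply/nd_allE/IH.
- move=> n G p t _ IH m sg; move: (IH m sg); rewrite subst_inst; exact: nd_exI.
- move=> n G p q _ IH1 _ IH2 m sg; apply: nd_exE (IH1 _ sg) _.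
  by rewrite weaken_subst -mapE; apply: IH2.
- by move=> n G t m sg; apply: nd_eqI.
- move=> n G p s t _ IH1 _ IH2 m sg; rewrite subst_inst.
  by apply: nd_eqE (IH1 _ sg) _; rewrite -subst_inst; apply: IH2.
- by move=> n G m sg /=; rewrite /up sconsE; apply: nd_dom.
Qed.

(** * Derivability from arbitrary sets of open formulas *)

(** Hypotheses form a predicate, not a list, because the contexts used for completeness contain a
    whole deductively closed set of sentences. *)
Definition prv n (X : form L n -> Prop) (p : form L n) : Prop :=
  exists G : seq (form L n), (forall g, List.In g G -> X g) /\ nd G p.

Definition image m n (f : form L m -> form L n) (X : form L m -> Prop) : form L n -> Prop :=
  fun q => exists2 p, X p & q = f p.

Definition adj n (X : form L n -> Prop) (p : form L n) : form L n -> Prop :=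
  fun q => X q \/ q = p.

Lemma prv_hyp n (X : form L n -> Prop) p : X p -> prv X p.
Proof.
move=> Xp; exists [:: p]; split=> [g /= [<-//|[]]|].
by apply: nd_hyp; left.
Qed.

(** Cut: the hypotheses in [H] are moved one by one into an implication and then detached. The rules
    for [prv] below mostly reduce to a short list derivation through this lemma. *)
Lemma prv_nd n (X : form L n -> Prop) (H : seq (form L n)) q :
  (forall p, List.In p H -> prv X p) -> nd H q -> prv X q.
Proof.
elim: H q => [|p H IH] q XH Hq; first by exists [::].
have [|G1 [X1 N1]] := IH (Imp p q) _ (nd_impI Hq).
  by move=> r Hr; apply: XH; right.
have [|G2 [X2 N2]] := XH p; first by left.
exists (G1 ++ G2); split=> [g /List.in_app_iff[/X1|/X2]//|].
by apply: nd_impE (nd_weakening N1 _) (nd_weakening N2 _) => g ?;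
  apply/List.in_app_iff; [left|right].
Qed.

Lemma prv_trans n (X Y : form L n -> Prop) q :
  (forall p, Y p -> prv X p) -> prv Y q -> prv X q.
Proof. by move=> XY [H [YH Hq]]; apply: prv_nd Hq => p /YH/XY. Qed.

Lemma prv_mono n (X Y : form L n -> Prop) q :
  (forall p, Y p -> X p) -> prv Y q -> prv X q.
Proof. by move=> XY; apply: prv_trans => p /XY/prv_hyp. Qed.

Lemma prv_adjl n (X : form L n -> Prop) p q : prv X q -> prv (adj X p) q.
Proof. by apply: prv_mono => r; left. Qed.

Lemma prv_adjr n (X : form L n -> Prop) p : prv (adj X p) p.
Proof. by apply: prv_hyp; right. Qed.

(** The rules of [nd] discharge only the head of the list, so all occurrences of [p] are collected
    there. *)
Lemma nd_split n (X : form L n -> Prop) p q G :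
  (forall g, List.In g G -> adj X p g) -> nd G q ->
  exists H, (forall g, List.In g H -> X g) /\ nd (p :: H) q.
Proof.
move=> XG Gq.
suff [H [XH sub]] : exists H, (forall g, List.In g H -> X g) /\
    forall g, List.In g G -> List.In g (p :: H).
  by exists H; split=> //; apply: (nd_weakening Gq).
elim: G XG {Gq} => [|g G IH] XG; first by exists [::].
have [|H [XH sub]] := IH; first by move=> h Gh; apply: XG; right.
have [Xg|->] : adj X p g by apply: XG; left.
- exists (g :: H); split=> [h /= [<-|/XH]//|h /= [->|/sub /= [->|Hh]]].
  + by right; left.
  + by left.
  + by right; right.
- by exists H; split=> // h /= [->|/sub//]; left.
Qed.

Lemma list_image m n (f : form L m -> form L n) X H :
  (forall h, List.In h H -> image f X h) ->
  exists G, (forall g, List.In g G -> X g) /\ H = [seq f g | g <- G].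
Proof.
elim: H => [|h H IH] XH; first by exists [::].
have [|G [XG ->]] := IH; first by move=> g Hg; apply: XH; right.
have [|g Xg ->] := XH h; first by left.
by exists (g :: G); split=> // k /= [<-|/XG].
Qed.

Lemma prv_raa n (X : form L n -> Prop) p : prv (adj X (Not p)) Bot -> prv X p.
Proof. by move=> [G [XG /(nd_split XG) [H [XH /nd_raa N]]]]; exists H. Qed.

Lemma prv_impI n (X : form L n -> Prop) p q : prv (adj X p) q -> prv X (Imp p q).
Proof. by move=> [G [XG /(nd_split XG) [H [XH /nd_impI N]]]]; exists H. Qed.

Lemma prv_allI n (X : form L n -> Prop) p :
  prv (image (@weaken L n) X) p -> prv X (All p).
Proof. by move=> [H [/list_image[G [XG ->]] /nd_allI N]]; exists G. Qed.

Lemma prv_impE n (X : form L n -> Prop) p q : prv X (Imp p q) -> prv X p -> prv X q.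
Proof.
move=> H1 H2; apply: (@prv_nd _ _ [:: Imp p q; p]) => [r /= [<-|[<-|[]]]//|].
by apply: (@nd_impE _ _ _ p); apply: nd_hyp; [left|right; left].
Qed.

Lemma prv_andI n (X : form L n -> Prop) p q : prv X p -> prv X q -> prv X (And p q).
Proof.
move=> H1 H2; apply: (@prv_nd _ _ [:: p; q]) => [r /= [<-|[<-|[]]]//|].
by apply: nd_andI; apply: nd_hyp; [left|right; left].
Qed.

Lemma prv_nd1 n (X : form L n -> Prop) p q : nd [:: p] q -> prv X p -> prv X q.
Proof. by move=> N Xp; apply: prv_nd N => r /= [<-|[]]. Qed.

Lemma nd_hyp1 n (p : form L n) : nd [:: p] p.
Proof. by apply: nd_hyp; left. Qed.

Lemma prv_andE1 n (X : form L n -> Prop) p q : prv X (And p q) -> prv X p.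
Proof. exact/prv_nd1/nd_andE1/nd_hyp1. Qed.

Lemma prv_andE2 n (X : form L n -> Prop) p q : prv X (And p q) -> prv X q.
Proof. exact/prv_nd1/nd_andE2/nd_hyp1. Qed.

Lemma prv_orI1 n (X : form L n -> Prop) p q : prv X p -> prv X (Or p q).
Proof. exact/prv_nd1/nd_orI1/nd_hyp1. Qed.

Lemma prv_orI2 n (X : form L n -> Prop) p q : prv X q -> prv X (Or p q).
Proof. exact/prv_nd1/nd_orI2/nd_hyp1. Qed.

Lemma prv_allE n (X : form L n -> Prop) p t : prv X (All p) -> prv X (inst p t).
Proof. exact/prv_nd1/nd_allE/nd_hyp1. Qed.

Lemma prv_exI n (X : form L n -> Prop) p t : prv X (inst p t) -> prv X (Ex p).
Proof. exact/prv_nd1/nd_exI/nd_hyp1. Qed.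

Lemma prv_orE n (X : form L n -> Prop) p q r :
  prv X (Or p q) -> prv X (Imp p r) -> prv X (Imp q r) -> prv X r.
Proof.
move=> H1 H2 H3.
apply: (@prv_nd _ _ [:: Or p q; Imp p r; Imp q r]) => [s /= [<-|[<-|[<-|[]]]]//|].
apply: (@nd_orE _ _ _ p q); first by apply: nd_hyp; left.
- by apply: (@nd_impE _ _ _ p); apply: nd_hyp; [do 2 right; left|left].
- by apply: (@nd_impE _ _ _ q); apply: nd_hyp; [do 3 right; left|left].
Qed.

Lemma prv_exE n (X : form L n -> Prop) p q : prv X (Ex p) ->
  prv (adj (image (@weaken L n) X) p) (weaken q) -> prv X q.
Proof.
move=> H1 [H [XH /(nd_split XH) [G [/list_image[G' [XG ->]] N]]]].
apply: (@prv_nd _ _ (Ex p :: G')) => [s /= [<-//|/XG/prv_hyp//]|].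
apply: nd_exE; first by apply: nd_hyp; left.
by apply: (nd_weakening N) => g /= [|]; [left|right; right].
Qed.

(** Leibniz replacement at chosen places: index 0 in the values of [sg] marks where [s] gives way to
    [t]. *)
Lemma prv_eqE n (X : form L n -> Prop) m (p : form L m) (sg : 'I_m -> term L n.+1) s t :
  prv X (Eq s t) -> prv X (subst p (fun i => subst_term (scons s Var) (sg i))) ->
  prv X (subst p (fun i => subst_term (scons t Var) (sg i))).
Proof.
rewrite -!subst_comp => H1 H2.
apply: (@prv_nd _ _ [:: Eq s t; inst (subst p sg) s]) => [r /= [<-|[<-|[]]]//|].
by apply: nd_eqE (nd_hyp _) (nd_hyp _); [left|right; left].
Qed.

Lemma prv_subst m n (X : form L m -> Prop) p (sg : 'I_m -> term L n) :
  prv X p -> prv (image (fun q => subst q sg) X) (subst p sg).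
Proof.
move=> [G [XG N]]; exists [seq subst g sg | g <- G]; split.
  by move=> g /List.in_map_iff[h [<- /XG Xh]]; exists h.
exact: nd_subst.
Qed.

(** Inside a scope opened by an eigenvariable, that variable itself is the witness. *)
Lemma prv_weaken_exI n (X : form L n.+1 -> Prop) p : prv X p -> prv X (weaken (Ex p)).
Proof. by move=> Xp; apply: (@prv_exI _ _ _ (Var ord0)); rewrite inst_up. Qed.

Lemma prv_weaken_allE n (X : form L n.+1 -> Prop) p : prv X (weaken (All p)) -> prv X p.
Proof. by move/(@prv_allE _ _ _ (Var ord0)); rewrite inst_up. Qed.

Lemma prv_foldl_and n (X : form L n -> Prop) (I : eqType) (f : I -> form L n) p s :
  prv X (foldl And p [seq f i | i <- s]) <->
  prv X p /\ forall i, i \in s -> prv X (f i).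
Proof.
elim: s p => [|i s IH] p /=; first by split=> [|[]].
rewrite IH; split=> [[Xpi Xs]|[Xp Xs]]; split.
- exact: prv_andE1 Xpi.
- by move=> j /predU1P[->|/Xs//]; apply: prv_andE2 Xpi.
- by apply: prv_andI => //; apply: Xs; rewrite mem_head.
- by move=> j js; apply: Xs; rewrite inE js orbT.
Qed.

End Deduction.

(** * Completeness of the rule *)

Section Completeness.
Variables (L E : signature) (A : structure L) (theta : A -> form L 1).
Variables (U : rsym (sig_ext L E)) (R : sentence (sig_ext L E) -> Prop).
Hypothesis theta_definable : pointwise_definable theta.
Hypothesis R_nd : forall s, prv R s -> R s.
Hypothesis R_uniq : forall a, R (rel_to U (uniq_sentence (theta a))).
Hypothesis R_diagram : forall s, diagram (range_of theta) A s -> R (rel_to U s).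
Hypothesis R_rule : forall phi : form L 1,
  (forall a, R (rel_to U (Ex (And phi (theta a))))) -> R (rel_to U (All phi)).

Local Notation L' := (sig_ext L E).

(** * Names for the elements of the model *)

(** The conjunct for [U] is what a relativized quantifier demands of its instances; with it a named
    term can instantiate such a quantifier. *)
Definition names a n (t : term L' n) : form L' n :=
  And (Pred1 U t) (app1 (rel_to U (theta a)) t).

Lemma subst_names a m n (t : term L' m) (sg : 'I_m -> term L' n) :
  subst (names a t) sg = names a (subst_term sg t).
Proof. by rewrite /names /= subst_app1. Qed.

Definition extends_R n (X : form L' n -> Prop) := forall s, R s -> prv X (lift0 n s).

Lemma extends_R_weaken n (X : form L' n -> Prop) :
  extends_R X -> extends_R (image (@weaken L' n) X).
Proof.
by move=> XR s /XR/(prv_subst (@shift L' n)); rewrite subst_lift0.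
Qed.

Lemma extends_R_adj n (X : form L' n -> Prop) p : extends_R X -> extends_R (adj X p).
Proof. by move=> XR s /XR/prv_adjl. Qed.

Lemma lift0_uniq n a :
  lift0 n (rel_to U (uniq_sentence (theta a))) =
  Ex (And (Pred1 U (Var ord0)) (And (app1 (rel_to U (theta a)) (Var ord0))
    (All (Imp (Pred1 U (Var ord0)) (Imp (app1 (rel_to U (theta a)) (Var ord0))
      (Eq (Var (lift ord0 ord0)) (Var ord0))))))).
Proof.
have -> : rel_to U (uniq_sentence (theta a)) =
  Ex (And (Pred1 U (Var ord0)) (And (app1 (rel_to U (theta a)) (Var ord0))
    (All (Imp (Pred1 U (Var ord0)) (Imp (app1 (rel_to U (theta a)) (Var ord0))
      (Eq (Var (lift ord0 ord0)) (Var ord0))))))).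
  by rewrite -!rel_to_app1 (app1_id (theta a)).
by rewrite /lift0 /= !subst_app1 /= /Pred1 /up !sconsE.
Qed.

Lemma names_ex n (X : form L' n -> Prop) a :
  extends_R X -> prv X (Ex (names a (Var ord0))).
Proof.
move=> XR; move: (XR _ (R_uniq a)); rewrite lift0_uniq => Xu.
apply: prv_exE Xu _; apply: prv_weaken_exI; apply: prv_andI.
- exact: prv_andE1 (prv_adjr _ _).
- exact: prv_andE1 (prv_andE2 (prv_adjr _ _)).
Qed.

(** Both terms equal the witness x of the relativized uniqueness sentence for [a]. *)
Lemma names_uniq n (X : form L' n -> Prop) a s t :
  extends_R X -> prv X (names a s) -> prv X (names a t) -> prv X (Eq s t).
Proof.
move=> XR Xs Xt; move: (XR _ (R_uniq a)); rewrite lift0_uniq => Xu.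
apply: prv_exE Xu _; set Y := adj _ _.
have Yeq u : prv X (names a u) -> prv Y (Eq (Var ord0) (subst_term (@shift L' n) u)).
  move/(prv_subst (@shift L' n)); rewrite subst_names => Xu'.
  have Yu : prv Y (names a (subst_term (@shift L' n) u)) by apply: prv_adjl.
  have := prv_andE2 (prv_andE2 (prv_adjr _ _ : prv Y _)).
  move/(@prv_allE _ _ _ _ (subst_term (@shift L' n) u)).
  rewrite /inst /= subst_app1 /= !sconsE => Yi.
  exact: prv_impE (prv_impE Yi (prv_andE1 Yu)) (prv_andE2 Yu).
(* Rewrites x = t into s = t by means of x = s. The left side is the marked place; [t] is shifted
   twice, once past x and once past the mark. *)
have := @prv_eqE _ _ Y 2
  (Eq (Var ord0) (Var (lift ord0 ord0)))
  (scons (Var ord0) (fun=> subst_term (@shift L' _) (subst_term (@shift L' n) t)))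
  _ _ (Yeq _ Xs).
rewrite /= !sconsE /= !sconsE !subst_term_comp /=.
have shiftK u : (fun i : 'I_n =>
   subst_term (fun j => scons u Var (lift ord0 j)) (@shift L' n i)) = @shift L' n.
  by apply: functional_extensionality => i /=; rewrite sconsE.
by rewrite !shiftK; apply; apply: Yeq.
Qed.

(* Any witness of [Ex p] is the element named by [t], so it can be replaced by [t]. *)
Lemma prv_ex_names n (X : form L' n -> Prop) a (p : form L' n.+1) t :
  extends_R X -> prv X (names a t) -> prv (eq p) (names a (Var ord0)) ->
  prv X (Ex p) -> prv X (inst p t).
Proof.
move=> XR Xt pa Xp; apply: prv_exE Xp _; set Y := adj _ _.
have Yp : prv Y p by apply: prv_adjr.
have Yeq : prv Y (Eq (Var ord0) (subst_term (@shift L' n) t)).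
  apply: (@names_uniq _ _ a); first exact/extends_R_adj/extends_R_weaken.
  - by apply: prv_trans pa => _ <-.
  - by rewrite -subst_names; apply/prv_adjl/prv_subst.
(* [up] keeps index 0 as the marked place, so the witness is replaced by [t] exactly where [p]
   refers to its bound variable. *)
have := @prv_eqE _ _ Y _ p (up (@shift L' n)) _ _ Yeq.
rewrite -!subst_comp -[X in prv Y X -> _]/(inst _ _) inst_up => /(_ Yp).
rewrite /weaken /inst !subst_comp.
congr (prv _ (subst _ _)).
by apply: ord_funext => [|i]; rewrite /up !sconsE /= ?sconsE.
Qed.

(** * Contexts that name the values of the variables *)

Definition ctx n (rho : 'I_n -> A) : form L' n -> Prop := fun q =>
  (exists2 s, R s & q = lift0 n s) \/ exists i, q = names (rho i) (Var i).

Lemma extends_R_ctx n (rho : 'I_n -> A) : extends_R (ctx rho).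
Proof. by move=> s Rs; apply: prv_hyp; left; exists s. Qed.

Lemma ctx_names n (rho : 'I_n -> A) i : prv (ctx rho) (names (rho i) (Var i)).
Proof. by apply: prv_hyp; right; exists i. Qed.

Lemma ctx_names0 n (rho : 'I_n -> A) a :
  prv (ctx (scons a rho)) (names a (Var ord0)).
Proof. by have := ctx_names (scons a rho) ord0; rewrite sconsE. Qed.

Lemma ctx_rename m n (f : 'I_m -> 'I_n) (rho : 'I_n -> A) q :
  prv (ctx (fun i => rho (f i))) q -> prv (ctx rho) (subst q (fun i => Var (f i))).
Proof.
move/(prv_subst (fun i => Var (f i))); apply: prv_trans => _ [r [[s Rs ->]|[i ->]] ->].
- by rewrite subst_lift0; apply: extends_R_ctx.
- by rewrite subst_names; apply: ctx_names.
Qed.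

Lemma ctx_weaken n (rho : 'I_n -> A) a q :
  prv (ctx rho) q -> prv (ctx (scons a rho)) (weaken q).
Proof.
move=> H; apply: ctx_rename; congr (prv (ctx _) q): H.
by apply: functional_extensionality => i; rewrite sconsE.
Qed.

(** The uniqueness sentence for [a] proves that something named [a] exists, so a fresh variable
    carrying that name can be discharged. *)
Lemma ctx_close n (rho : 'I_n -> A) a q :
  prv (ctx (scons a rho)) (weaken q) -> prv (ctx rho) q.
Proof.
move=> H; apply: prv_exE (names_ex a (@extends_R_ctx _ rho)) _.
apply: prv_trans H => _ [[s Rs ->]|[i ->]].
- exact/extends_R_adj/Rs/extends_R_weaken/extends_R_ctx.
- case: (unliftP ord0 i) => [j|] ->; rewrite sconsE; last exact: prv_adjr.
  apply/prv_adjl/prv_hyp; exists (names (rho j) (Var j)); first by right; exists j.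
  by rewrite /weaken subst_names.
Qed.

Lemma ctx_closed (rho : 'I_0 -> A) s : prv (ctx rho) s -> R s.
Proof.
move=> H; apply: R_nd; apply: prv_trans H => _ [[r Rr ->]|[[]//]].
by rewrite lift0_0; apply: prv_hyp.
Qed.

(* The parameters [rho] are eliminated one at a time, [p] being replaced by
   ex y (p /\ th_b(y)) with the parameter named [b] bound to y. *)
Lemma ctx_omega n : forall (p : form L n.+1) (rho : 'I_n -> A),
  (forall a, prv (ctx (scons a rho)) (rel_to U p)) ->
  prv (ctx rho) (rel_to U (All p)).
Proof.
elim: n => [|n IH] p rho Hp.
  (* Without parameters [p] has one free variable and the rule applies directly. The witness for its
     premise at [a] is a fresh variable naming [a]. *)
  rewrite -[rel_to U (All p)]lift0_0; apply: extends_R_ctx; apply: R_rule => a.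
  apply: (@ctx_closed rho); apply: (@ctx_close _ _ a); apply: prv_weaken_exI.
  have Na := ctx_names0 rho a.
  apply: prv_andI (prv_andE1 Na) (prv_andI (Hp a) _).
  by move: (prv_andE2 Na); rewrite app1_id.
set b := rho ord0; set rho' := fun i => rho (lift ord0 i).
have rhoE : rho = scons b rho' by apply: scons_eta.
(* In [p] index 0 is the variable x to be generalized and index 1 the parameter named [b]; below the
   new quantifier of [q] the two are exchanged. *)
pose swap : 'I_n.+2 -> 'I_n.+2 :=
  scons (lift ord0 ord0) (scons ord0 (fun i => lift ord0 (lift ord0 i))).
pose q := Ex (And (subst p (fun i => Var (swap i))) (app1 (theta b) (Var ord0))).
have Hq a : prv (ctx (scons a rho')) (rel_to U q).
  (* The witness for y is a fresh variable naming [b]. *)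
  apply: (@ctx_close _ _ b); apply: prv_weaken_exI.
  have Nb := ctx_names0 (scons a rho') b.
  apply: prv_andI (prv_andE1 Nb) (prv_andI _ _); last first.
    rewrite -[X in prv _ X]/(rel_to U (app1 (theta b) (Var ord0))) rel_to_app1.
    exact: prv_andE2 Nb.
  rewrite -[X in prv _ X]/(rel_to U (subst p _)) rel_to_subst; apply: ctx_rename.
  move: (Hp a); congr (prv (ctx _) _); rewrite rhoE.
  apply: ord_funext => [|i]; first by rewrite /swap !sconsE.
  by case: (unliftP ord0 i) => [j|] ->; rewrite /swap !sconsE.
(* The induction hypothesis generalizes x in [q]; the parameter [b] then returns to the context.
   What remains is to recover [p] from [q]. *)
have := ctx_weaken b (IH q rho' Hq); rewrite -rhoE => Xq.
have XR : extends_R (ctx rho) by apply: extends_R_ctx.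
have Xb : prv (ctx rho) (names b (Var ord0)) by apply: ctx_names.
move: (ctx rho) Xq XR Xb => X Xq XR Xb.
apply/prv_allI/prv_impI; set Y := adj _ _.
have YR : extends_R Y by apply/extends_R_adj/extends_R_weaken.
have Yb : prv Y (names b (Var (lift ord0 ord0))).
  by apply: prv_adjl; have := prv_subst (@shift L' _) Xb; rewrite subst_names.
have YU : prv Y (Pred1 U (Var ord0)) by apply: prv_adjr.
(* Places the variables of [q] in the present scope: x stays at index 0 and the others skip index 1,
   which belongs to [b]. *)
pose tau := scons (Var ord0) (fun i : 'I_n => @Var L' n.+2 (lift ord0 (lift ord0 i))).
have allE2 r : prv Y (weaken (weaken (All r))) -> prv Y (subst r tau).
  move/(@prv_allE _ _ _ _ (Var ord0)); rewrite /inst !subst_comp.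
  congr (prv _ (subst _ _)).
  by apply: ord_funext => [|i]; do 3 rewrite /tau /up ?sconsE /=.
have qE : rel_to U (All q) = All (Imp (Pred1 U (Var ord0)) (Ex (And (Pred1 U (Var ord0))
    (And (subst (rel_to U p) (fun i => Var (swap i)))
      (app1 (rel_to U (theta b)) (Var ord0)))))).
  by rewrite -rel_to_app1 -[subst _ _](rel_to_subst U p (fun i => Var (swap i))).
rewrite -[X in prv Y X]/(rel_to U p).
move: (rel_to U p) qE => p' qE; rewrite qE in Xq.
have Yex : prv Y (Ex (And (Pred1 U (Var ord0))
    (And (subst p' (fun i => up tau (swap i))) (app1 (rel_to U (theta b)) (Var ord0))))).
  have := allE2 _ (prv_adjl _ (prv_subst (@shift L' _) Xq)).
  rewrite /= subst_comp subst_app1 /= /Pred1 /up [tau ord0]sconsE !sconsE.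
  by move/prv_impE; apply.
(* The bound y is named [b], as is the variable of index 1, so that variable may replace y. The
   composite of all the renamings is then the identity on [p]. *)
have := @prv_ex_names _ _ b _ (Var (lift ord0 ord0)) YR Yb _ Yex.
rewrite /inst /= subst_comp => /(_ _)/prv_andE2/prv_andE1 H.
rewrite -[p']subst_id; suff -> : Var =
    fun i => subst_term (scons (Var (lift ord0 ord0)) Var) (up tau (swap i)).
  apply: H; apply: (@prv_nd1 _ _ _ (And _ (And _ _))) (prv_hyp erefl).
  apply: nd_andI; first exact/nd_andE1/nd_hyp1.
  exact/nd_andE2/nd_andE2/nd_hyp1.
apply: ord_funext => [|i]; first by do 3 rewrite /swap /up /tau ?sconsE /=.
by case: (unliftP ord0 i) => [j|] ->; do 3 rewrite /swap /up /tau ?sconsE /=.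
Qed.

(** * Atomic formulas from the diagram *)

(** Passes between a diagram sentence and its matrix. The matrix yields its existential closure
    because the variables lie in [U]; conversely, since [c] entails the naming formulas, the
    witnesses of the closure can only be the named variables. *)
Lemma ctx_exs n : forall (c : form L n) (rho : 'I_n -> A),
  (forall i, prv (eq (rel_to U c)) (app1 (rel_to U (theta (rho i))) (Var i))) ->
  prv (ctx rho) (Imp (rel_to U c) (lift0 n (rel_to U (exs c)))) /\
  (R (rel_to U (exs c)) -> prv (ctx rho) (rel_to U c)).
Proof.
elim: n => [|n IH] c rho Hc.
  rewrite lift0_0; split; first exact/prv_impI/prv_adjr.
  by move=> Rc; rewrite -[rel_to U c]lift0_0; apply: extends_R_ctx.
set rho' := fun i => rho (lift ord0 i).
have rhoE : rho = scons (rho ord0) rho' by apply: scons_eta.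
(* Quantifying the variable of index 0 preserves the naming formulas of the remaining variables. *)
have [i|H1 H2] := IH (Ex c) rho'.
  apply: prv_exE (prv_hyp erefl) _; rewrite /weaken subst_app1.
  by apply: prv_trans (Hc _) => _ <-; apply: prv_andE2 (prv_adjr _ _).
split.
- have := ctx_weaken (rho ord0) H1; rewrite -rhoE => {}H1; apply: prv_impI.
  have : prv (adj (ctx rho) (rel_to U c)) (Imp (weaken (rel_to U (Ex c)))
      (weaken (lift0 n (rel_to U (exs (Ex c)))))) by apply: prv_adjl.
  rewrite [weaken (lift0 _ _)]subst_lift0 => /prv_impE; apply.
  apply: (@prv_weaken_exI _ _ _ (And _ _)); apply: prv_andI; last exact: prv_adjr.
  by apply/prv_adjl; apply: prv_andE1 (ctx_names rho ord0).
- move=> /H2/(ctx_weaken (rho ord0)); rewrite -rhoE => {}H2.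
  (* The witness of the outer quantifier is named [rho ord0], hence replaceable by the variable of
     index 0; this instance of the weakened matrix is the original one. *)
  have := @prv_ex_names _ _ (rho ord0)
    (subst (And (Pred1 U (Var ord0)) (rel_to U c)) (up (@shift L' n))) (Var ord0)
    (@extends_R_ctx _ rho) (ctx_names _ _) _ H2.
  rewrite inst_up.
  move=> H; apply: prv_andE2 (H _) => {H}.
  have /(prv_subst (up (@shift L' n))) : prv (eq (And (Pred1 U (Var ord0)) (rel_to U c)))
      (names (rho ord0) (Var ord0)).
    apply: prv_andI; first exact: prv_andE1 (prv_hyp erefl).
    by apply: prv_trans (Hc _) => _ <-; apply: prv_andE2 (prv_hyp erefl).
  rewrite subst_names /= {2}/up sconsE.
  by apply: prv_mono => _ [_ <- ->].
Qed.

Lemma models_exs n (c : form L n) : models A (exs c) <-> exists rho : 'I_n -> A, sat c rho.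
Proof.
elim: n c => [|n IH] c /=.
  split=> [Hc|[rho Hc] rho']; last by rewrite (ord0_funext rho' rho).
  have [a] := carrier_inh A.
  by exists (fun=> a); apply: Hc.
rewrite IH; split=> [[rho [a Ha]]|[rho Hrho]]; first by exists (scons a rho).
by exists (fun i => rho (lift ord0 i)), (rho ord0); rewrite -scons_eta.
Qed.

Lemma sat_foldl_and n (rho : 'I_n -> A) (I : eqType) (f : I -> form L n) p s :
  sat (foldl And p [seq f i | i <- s]) rho <->
  sat p rho /\ forall i, i \in s -> sat (f i) rho.
Proof.
elim: s p => [|i s IH] p /=; first by split=> [|[]].
rewrite IH; split=> [[[Hp Hi] Hs]|[Hp Hs]]; split=> //.
- by move=> j /predU1P[->|/Hs].
- by split=> //; apply: Hs; rewrite mem_head.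
- by move=> j js; apply: Hs; rewrite inE js orbT.
Qed.

Lemma rel_to_foldl_and n I (f : I -> form L n) p s :
  rel_to U (foldl And p [seq f i | i <- s]) =
  foldl And (rel_to U p) [seq rel_to U (f i) | i <- s].
Proof. by elim: s p => [|i s IH] p //=; rewrite IH. Qed.

(** Both halves are carried through one induction, since implication turns truth of its premise into
    falsity and back. *)
Definition decided n (p : form L n) (rho : 'I_n -> A) : Prop :=
  (sat p rho -> prv (ctx rho) (rel_to U p)) /\
  (~ sat p rho -> prv (ctx rho) (Not (rel_to U p))).

(** Conjoining [p] with the formulas naming [rho] and closing existentially gives a [theta]-atomic
    sentence. By pointwise definability it is true exactly when [p] holds at [rho], so it or its
    negation lies in the diagram. At least one variable is required because such sentences begin
    with a quantifier. *)
Lemma decided_atomicS n (p : form L n.+1) rho : atomic p -> decided p rho.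
Proof.
move=> p_atomic.
(* Diagram sentences number their variables from the outermost quantifier, opposite to de Bruijn
   indices; hence the reversal. *)
pose f i := app1 (theta (rho (rev_ord i))) (Var (rev_ord i) : term L n.+1).
pose c := foldl And p [seq f i | i <- enum 'I_n.+1].
have c_atomic : theta_atomic (range_of theta) (exs c).
  by exists n, p, (fun i => theta (rho (rev_ord i))); split=> // i; exists (rho (rev_ord i)).
have satc : models A (exs c) <-> sat p rho.
  have satf rho' i : sat (f i) rho' <-> rho' (rev_ord i) = rho (rev_ord i).
    by rewrite -theta_definable /f /app1 sat_subst.
  rewrite models_exs; split=> [[rho' /sat_foldl_and[Hp Hf]]|Hp].
  - suff <- : rho' = rho by [].
    apply: functional_extensionality => i; rewrite -[i]rev_ordK.
    by apply/satf/Hf; rewrite mem_enum.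
  - by exists rho; apply/sat_foldl_and; split=> // i _; apply/satf.
have prvc (X : form L' n.+1 -> Prop) : prv X (rel_to U c) <-> prv X (rel_to U p) /\
    forall i, prv X (app1 (rel_to U (theta (rho i))) (Var i)).
  rewrite rel_to_foldl_and prv_foldl_and; split=> -[Xp Xf]; split=> // i.
  - by have := Xf (rev_ord i); rewrite /f rel_to_app1 rev_ordK mem_enum; apply.
  - by rewrite /f rel_to_app1.
have [i|H1 H2] := @ctx_exs _ c rho.
  by have /prvc[] := prv_hyp (erefl : eq (rel_to U c) (rel_to U c)).
split=> Hp.
- have /H2/prvc[] // : R (rel_to U (exs c)).
  by apply: R_diagram; split; [left|apply/satc].
- have Rc : R (rel_to U (Not (exs c))).
    apply: R_diagram; split; first by right; exists (exs c).
    by move=> rho0 /= Hc; apply/Hp/satc => rho1; rewrite (ord0_funext rho1 rho0).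
  apply: prv_impI; have := prv_adjl (rel_to U p) (@extends_R_ctx _ rho _ Rc).
  move=> /prv_impE; apply; apply: prv_impE (prv_adjl _ H1) _; apply/prvc.
  split; first exact: prv_adjr.
  by move=> i; apply/prv_adjl; apply: prv_andE2 (ctx_names rho i).
Qed.

Lemma rel_to_weaken n (p : form L n) : rel_to U (weaken p) = weaken (rel_to U p).
Proof. exact: rel_to_subst. Qed.

Lemma atomic_weaken n (p : form L n) : atomic p -> atomic (weaken p).
Proof. by case: p. Qed.

(** A closed atomic formula is given a dummy variable naming an arbitrary element, which is
    discharged afterwards. *)
Lemma decided_atomic n (p : form L n) rho : atomic p -> decided p rho.
Proof.
case: n p rho => [|n] p rho p_atomic; last exact: decided_atomicS.
have [a] := carrier_inh A.
have [] : decided (weaken p) (scons a rho) by apply/decided_atomicS/atomic_weaken.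
have satE : sat (weaken p) (scons a rho) <-> sat p rho.
  rewrite sat_subst; suff -> : (fun i => eval (scons a rho) (@shift L 0 i)) = rho by [].
  exact: ord0_funext.
rewrite /decided satE rel_to_weaken => H1 H2; split=> Hp; apply: (@ctx_close _ _ a);
  [exact: H1|exact: H2].
Qed.

(** * The truth lemma *)

Lemma prv_botE n (X : form L' n -> Prop) p : prv X Bot -> prv X p.
Proof. by move=> H; apply/prv_raa/prv_adjl. Qed.

(** The rule enters in two cases, a true universal and a false existential formula. For a false
    universal or a true existential one, a fresh variable naming the counterexample or witness is
    added and then discharged. *)
Lemma truth n (p : form L n) : forall rho, decided p rho.
Proof.
elim: p => {n} [n|n s t|n r ts|n p IHp q IHq|n p IHp q IHq|n p IHp q IHq
  |n p IHp|n p IHp] rho.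
- by split=> // _; apply/prv_impI/prv_adjr.
- exact: decided_atomic.
- exact: decided_atomic.
- have [Tp Fp] := IHp rho; have [Tq Fq] := IHq rho; split=> /= H.
  + apply: prv_impI; case: (classic (sat p rho)) => [/H/Tq|/Fp Hp]; first exact: prv_adjl.
    exact: prv_botE (prv_impE (prv_adjl _ Hp) (prv_adjr _ _)).
  + have [/Tp Hp nq] : sat p rho /\ ~ sat q rho by apply: imply_to_and.
    apply: prv_impI; apply: prv_impE (prv_adjl _ (Fq nq)) _.
    exact: prv_impE (prv_adjr _ _) (prv_adjl _ Hp).
- have [Tp Fp] := IHp rho; have [Tq Fq] := IHq rho; split=> /= [[/Tp Hp /Tq Hq]|].
  + exact: prv_andI.
  + case/not_and_or=> [/Fp|/Fq] H; apply/prv_impI; apply: prv_impE (prv_adjl _ H) _.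
    * exact: prv_andE1 (prv_adjr _ _).
    * exact: prv_andE2 (prv_adjr _ _).
- have [Tp Fp] := IHp rho; have [Tq Fq] := IHq rho; split=> /= [[/Tp|/Tq]|].
  + exact: prv_orI1.
  + exact: prv_orI2.
  + case/not_or_and=> [/Fp Hp /Fq Hq]; apply/prv_impI.
    exact: prv_orE (prv_adjr _ _) (prv_adjl _ Hp) (prv_adjl _ Hq).
- split=> [H|/not_all_ex_not[a /(proj2 (IHp (scons a rho))) Ha]].
  + by apply: ctx_omega => a; apply: (proj1 (IHp _)); apply: H.
  + apply: (@ctx_close _ _ a); apply: prv_impI; apply: prv_impE (prv_adjl _ Ha) _.
    have /(@prv_weaken_allE _ _ _ (Imp _ _)) H := prv_adjr (ctx (scons a rho)) (weaken (rel_to U (All p))).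
    by apply: prv_impE H _; apply/prv_adjl; apply: prv_andE1 (ctx_names0 rho a).
- split=> [[a /(proj1 (IHp (scons a rho))) Ha]|/not_ex_all_not H].
  + apply: (@ctx_close _ _ a); apply: (@prv_weaken_exI _ _ _ (And _ _)).
    by apply: prv_andI Ha; apply: prv_andE1 (ctx_names0 rho a).
  (* A false existential formula is refuted through the universal closure of its negated matrix,
     obtained from the rule. *)
  + have Hn : prv (ctx rho) (rel_to U (All (Not p))).
      by apply: ctx_omega => a; apply: (proj2 (IHp _)); apply: H.
    apply: prv_impI; apply: prv_exE (prv_adjr _ _) _.
    set Y := adj _ _.
    have /(@prv_weaken_allE _ _ _ (Imp _ _)) HY : prv Y (weaken (rel_to U (All (Not p)))).
      by apply/prv_adjl; apply: prv_subst (prv_adjl _ Hn).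
    have Yp := prv_adjr _ _ : prv Y _.
    exact: prv_impE (prv_impE HY (prv_andE1 Yp)) (prv_andE2 Yp).
Qed.

Lemma true_relativized s : models A s -> R (rel_to U s).
Proof.
have [a] := carrier_inh A; pose rho : 'I_0 -> A := fun=> a.
by move/(_ rho)/(proj1 (truth s rho))/ctx_closed.
Qed.

End Completeness.

(** * Soundness of the rule *)

Section Soundness.
Variables (L E : signature) (A : structure L) (theta : A -> form L 1).
Variables (T : theory (sig_ext L E)).
Variables (P : theory (sig_ext L E) -> sentence (sig_ext L E) -> Prop).
Variable U : rsym (sig_ext L E).
Hypothesis P_provability : provability P.
Hypothesis theta_definable : pointwise_definable theta.
Hypothesis T_sound : forall s : sentence L, P T (rel_to U s) -> models A s.

Lemma provability_hyp (S : theory (sig_ext L E)) s : S s -> P S s.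
Proof. by move=> Ss; apply: prv_classical => //; apply: prv_hyp. Qed.

Lemma provability_mono (S S' : theory (sig_ext L E)) s :
  (forall t, S t -> S' t) -> P S s -> P S' s.
Proof.
by move=> SS'; apply: prv_cut => // t /SS'; apply: provability_hyp.
Qed.

(** Relativization commutes with implication, so discharging a true premise leaves the
    relativization of an implication, to which the induction hypothesis applies. *)
Lemma sound_list (G : seq (sentence (sig_ext L E))) s :
  (forall g, List.In g G -> Th_rel U A g) ->
  P (fun t => T t \/ List.In t G) (rel_to U s) -> models A s.
Proof.
elim: G s => [|g G IH] s GA Ps.
  by apply: T_sound; apply: provability_mono Ps => t [|[]].
have [|r gE Ar] := GA g; first by left.
suff Ars : models A (Imp r s) by move=> rho; apply/Ars/Ar.
apply: IH => [h Gh|]; first by apply: GA; right.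
rewrite -[rel_to U _]/(Imp (rel_to U r) (rel_to U s)) -gE.
apply: prv_deduction => //; apply: provability_mono Ps => t /= [|[->|]]; by auto.
Qed.

Lemma sound_true s :
  P (fun t => T t \/ Th_rel U A t) (rel_to U s) -> models A s.
Proof.
case/(prv_finitary P_provability)=> G [GT Ps].
have [H [HA GH]] : exists H, (forall h, List.In h H -> Th_rel U A h) /\
    forall g, List.In g G -> T g \/ List.In g H.
  elim: G GT {Ps} => [|g G IH] GT; first by exists [::].
  have [|H [HA GH]] := IH; first by move=> h Gh; apply: GT; right.
  have [|Tg|Ag] := GT g; first by left.
  - by exists H; split=> // h /= [<-|/GH]; auto.
  - exists (g :: H); split=> [h /= [<-|/HA]//|h /= [<-|/GH[]]]; by auto.
by apply: sound_list HA (provability_mono GH Ps).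
Qed.

Lemma rule_prv_sound t : rule_prv P (range_of theta) U T t ->
  P (fun t => T t \/ Th_rel U A t) t.
Proof.
elim=> {t} [s Ts|S s _ IH Ps|phi _ IH].
- by apply: provability_hyp; left.
- exact: prv_cut Ps.
(* The conclusion of the rule is shown to belong to [Th_rel U A], so only its truth is at stake. For
   each [a], the premise at [a] is true and has a witness, which by definability is [a] itself. *)
- apply: provability_hyp; right; exists (All phi) => // rho a.
  have /sound_true/(_ rho)/= [b [Hb]] := IH _ (ex_intro _ a erefl).
  have rhoE x : scons x rho = fun=> x by apply: ord_funext => [|[]//]; rewrite sconsE.
  by rewrite {1}rhoE => /theta_definable <-.
Qed.

End Soundness.

(** * Derivability with the rule coincides with truth *)

Theorem theorem4 (L E : signature) (A : structure L) (theta : A -> form L 1)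
    (T : theory (sig_ext L E))
    (P : theory (sig_ext L E) -> sentence (sig_ext L E) -> Prop)
    (U : rsym (sig_ext L E))
    (P_provability : provability P)
    (U_unary : rar U = 1)
    (theta_definable : pointwise_definable theta)
    (theta_uniq : forall a : A, uniqueness_formula P T (embed E (theta a)))
    (theta_uniq_rel : forall a : A, P T (rel_to U (uniq_sentence (theta a))))
    (theta_in_U : forall a : A,
      P T (All (Imp (embed E (theta a)) (Pred1 U (Var ord0)))))
    (T_diagram : forall s : sentence L,
      diagram (range_of theta) A s -> P T (rel_to U s))
    (T_sound : forall s : sentence L, P T (rel_to U s) -> models A s) :
  (forall s : sentence L, rule_prv P (range_of theta) U T (rel_to U s) <-> models A s) /\
  (forall t : sentence (sig_ext L E),
     (exists2 s : sentence L, t = rel_to U s & rule_prv P (range_of theta) U T t) <->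
     Th_rel U A t).

Proof.
have soundness s : rule_prv P (range_of theta) U T (rel_to U s) -> models A s.
  by move/(rule_prv_sound P_provability theta_definable T_sound)/sound_true; apply.
have completeness s : models A s -> rule_prv P (range_of theta) U T (rel_to U s).
  have PR t : P T t -> rule_prv P (range_of theta) U T t.
    by apply: rule_prv_base => r; apply: rule_prv_ax.
  (* The closed set [R] of the completeness argument is taken to be the set of sentences derivable
     from [T] with the rule. *)
  apply: true_relativized theta_definable _ _ _ _ _ => //.
  - by move=> r Hr; apply: rule_prv_base (prv_classical P_provability Hr).
  - by move=> a; apply/PR/theta_uniq_rel.
  - by move=> r /T_diagram/PR.
  - by move=> phi Hphi; apply: rule_prv_rule => _ [a ->]; apply: Hphi.
split=> [s|t]; first by split; [apply: soundness|apply: completeness].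
split=> -[s -> Hs]; exists s => //; first exact: soundness.
exact: completeness.
Qed.
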